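(* For every integer $n\ge 2$, the price of MMS with respect to egalitarian welfare for allocating contiguous blocks of chores to $n$ agents is $\mathrm{PoF}_n=\frac n2$.
   Context: A fair-chores instance $\mathcal I=\langle N,E,\mathcal V\rangle$ consists of agents $N=\{1,\dots,n\}$, indivisible items $E=\{e_1,\dots,e_m\}$ placed on a path in this order, and for each agent $i$ an additive valuation $v_i$ (i.e. $v_i(S)=\sum_{e\in S}v_i(e)$) with $v_i(e)\le 0$ for all $e\in E$, normalized so that $v_i(\emptyset)=0$, $v_i(E)=-1$. A bundle is connected if it is a set of consecutive items (the empty set is allowed). An allocation $\mathbf A=(A_1,\dots,A_n)$ is a partition of $E$ into $n$ pairwise disjoint connected (possibly empty) bundles, $A_i$ being given to agent $i$ (the left-to-right order of the agents' bundles is arbitrary). Its egalitarian welfare is $\mathsf{EW}(\mathbf A)=\min_{i\in N}v_i(A_i)$; $\mathsf{OPT}_E(\mathcal I)$ is the maximum of $\mathsf{EW}$ over all allocations of $\mathcal I$. The maximin share of agent $i$ is $\mathsf{MMS}_i(\mathcal I)=\max_{\mathbf X}\min_{j\in[n]}v_i(X_j)$, the maximum over all partitions $\mathbf X=(X_1,\dots,X_n)$ of $E$ into $n$ connected (possibly empty) bundles. An allocation $\mathbf A$ is MMS fair if $v_i(A_i)\ge \mathsf{MMS}_i(\mathcal I)$ for all $i\in N$. The price of fairness is $\mathrm{PoF}_n=\sup_{\mathcal I}\min_{\mathbf A}\frac{\mathsf{EW}(\mathbf A)}{\mathsf{OPT}_E(\mathcal I)}$, the supremum over all fair-chores instances with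 $n$ agents (any number of items) and the minimum over all MMS fair allocations $\mathbf A$ of $\mathcal I$; conventions: $c/0=+\infty$ for $c<0$ and $0/0=1$. *)

(* Defs.v *)
From mathcomp Require Import all_boot all_order all_algebra.
From mathcomp Require Import all_classical all_reals ereal.

Set Implicit Arguments.
Unset Strict Implicit.
Unset Printing Implicit Defensive.

Import Order.TTheory GRing.Theory Num.Theory.
Local Open Scope ring_scope.

(* The items are the elements of 'I_items, on a path in their natural order. *)
Record chores (R : realType) (n : nat) := Chores {
  items : nat;
  item_value : 'I_n -> 'I_items -> R;
  item_value_le0 : forall i e, item_value i e <= 0;
  item_value_total : forall i, \sum_(e < items) item_value i e = -1
}.

Definition value (R : realType) (n : nat) (I : chores R n)
    (i : 'I_n) (S : {set 'I_(items I)}) : R :=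
  \sum_(e in S) item_value i e.

Definition connected_bundle (m : nat) (S : {set 'I_m}) : bool :=
  [exists a : 'I_m.+1, exists b : 'I_m.+1, S == [set e : 'I_m | a <= e < b]%N].

(* Bundles are indexed by 'I_n; their left-to-right order on the path is free
   and any number of them may be empty, which is why [finset.partition] is not
   used. *)
Definition allocation (n m : nat) (A : {ffun 'I_n -> {set 'I_m}}) : bool :=
  [&& [forall i, connected_bundle (A i)],
      [forall i, forall j, (i != j) ==> [disjoint A i & A j]] &
      (\bigcup_i A i)%SET == [set: 'I_m]%SET].

(* Finite minima and maxima are taken in \bar R, where +oo is neutral for min and
   -oo for max; for n >= 1 the index sets in [EW], [OPT] and [MMS] are nonempty,
   so their values are finite. *)
Definition EW (R : realType) (n : nat) (I : chores R n)
    (A : {ffun 'I_n -> {set 'I_(items I)}}) : \bar R :=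
  \big[Order.min/+oo%E]_(i < n) (value i (A i))%:E.

Definition OPT (R : realType) (n : nat) (I : chores R n) : \bar R :=
  \big[Order.max/-oo%E]_(A : {ffun 'I_n -> {set 'I_(items I)}} | allocation A)
    EW A.

Definition MMS (R : realType) (n : nat) (I : chores R n) (i : 'I_n) : \bar R :=
  \big[Order.max/-oo%E]_(X : {ffun 'I_n -> {set 'I_(items I)}} | allocation X)
    \big[Order.min/+oo%E]_(j < n) (value i (X j))%:E.

Definition MMS_fair (R : realType) (n : nat) (I : chores R n)
    (A : {ffun 'I_n -> {set 'I_(items I)}}) : bool :=
  allocation A && [forall i, (MMS I i <= (value i (A i))%:E)%E].

(* [c / o] for finite [c <= o <= 0], with the conventions 0 / 0 = 1 and
   c / 0 = +oo for c < 0; ereal division has other values at 0. *)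
Definition welfare_ratio (R : realType) (c o : \bar R) : \bar R :=
  if o == 0%E then (if c == 0%E then 1%E else +oo%E) else (fine c / fine o)%:E.

(* Would be +oo if there were no MMS fair allocation. *)
Definition instance_price (R : realType) (n : nat) (I : chores R n) : \bar R :=
  \big[Order.min/+oo%E]_(A : {ffun 'I_n -> {set 'I_(items I)}} | MMS_fair A)
    welfare_ratio (EW A) (OPT I).

Definition PoF (R : realType) (n : nat) : \bar R :=
  ereal_sup [set instance_price I | I in [set: chores R n]]%classic.

(* Main.v *)
Require Import Defs.
From mathcomp Require Import all_boot all_order all_algebra.
From mathcomp Require Import all_classical all_reals ereal.
From mathcomp Require Import zify ring lra.

Import Order.TTheory GRing.Theory Num.Theory.
Local Open Scope ring_scope.

(* Write w < 0 for the optimal egalitarian welfare.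

   Upper bound. If no optimal allocation is MMS fair, some agent has maximin
   share above w, so n w < -1 and T := (n / 2) w <= -1/2. Asking every agent i to
   get at least max(MMS_i, T) is feasible: call i good if MMS_i >= T. Cut off the
   longest prefix acceptable to some remaining good agent; the remaining good
   agents can still split the rest into one bundle fewer. Give the prefix to a
   bad agent who accepts it, if there is one. Otherwise give it to the good
   agent, and if a bad agent remains, she values the prefix below -1/2, hence the
   whole rest above -1/2, and can take all of it.

   Lower bound. Agent 0 has costs (1 - x)/n, x/n, 1/n, ..., 1/n and so maximin
   share -1/n; every other agent has cost 1/2 for items 1 and 2 only. Agent 0
   cannot fairly take both items 1 and 2, so fair welfare is at most -1/2, but
   giving her exactly these two yields welfare -(1 + x)/n; let x tend to 0. *)

(** * Connected bundles and their values *)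

Definition interval_bundle (m a b : nat) : {set 'I_m} :=
  [set e : 'I_m | a <= e < b]%N.

Lemma connected_bundleP (m : nat) (S : {set 'I_m}) :
  reflect (exists a b : nat, S = interval_bundle m a b) (connected_bundle S).
Proof.
apply: (iffP existsP) => [[a /existsP[b /eqP ->]]|[a [b ->]]].
  by exists a, b.
(* The definition bounds the endpoints, so arbitrary ones are clipped at [m]. *)
have trunc k : (minn k m < m.+1)%N by rewrite ltnS geq_minr.
exists (Ordinal (trunc a)); apply/existsP; exists (Ordinal (trunc b)).
by apply/eqP/setP => e; rewrite !inE /=; have := ltn_ord e; lia.
Qed.

Lemma connected_bundle0 (m : nat) : connected_bundle (finset.set0 : {set 'I_m}).
Proof.
apply/connected_bundleP; exists 0%N, 0%N.
by apply/setP => e; rewrite !inE; lia.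
Qed.

Lemma value_le0 {R : realType} {n : nat} {I : chores R n} (i : 'I_n)
  (S : {set 'I_(items I)}) : value i S <= 0.
Proof. by apply: sumr_le0 => e _; apply: item_value_le0. Qed.

Lemma value_set0 {R : realType} {n : nat} {I : chores R n} (i : 'I_n) :
  value i (finset.set0 : {set 'I_(items I)}) = 0.
Proof. by rewrite /value finset.big_set0. Qed.

Lemma le_value_subset {R : realType} {n : nat} {I : chores R n} (i : 'I_n)
  (S T : {set 'I_(items I)}) : S \subset T -> value i T <= value i S.
Proof.
move=> sST; rewrite /value [leLHS](big_setID S) /= (finset.setIidPr sST).
by rewrite gerDl; apply: value_le0.
Qed.

Lemma value_disjoint_ge {R : realType} {n : nat} {I : chores R n} (i : 'I_n)
  (S T : {set 'I_(items I)}) : [disjoint S & T] -> -1 <= value i S + value i T.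
Proof.
move=> dST; rewrite /value -bigU //=.
rewrite (eq_bigl (mem (S :|: T))) => [|e]; last by rewrite !inE.
rewrite -/(value i _).
have <- : value i [set: 'I_(items I)]%SET = -1.
  by rewrite -(item_value_total I i); apply: eq_bigl => e; rewrite inE.
by apply: le_value_subset; apply/fintype.subsetP => e; rewrite inE.
Qed.

(** * Covers and the greedy assignment *)

(* The covering bundles may overlap and come in any order: only their number
   matters. *)
Definition coverable {R : realType} {n : nat} (I : chores R n) (i : 'I_n)
    (s : R) (k a : nat) : Prop :=
  exists2 L : seq {set 'I_(items I)}, (size L <= k)%N &
    (forall S, S \in L -> connected_bundle S /\ s <= value i S) /\
    (forall e : 'I_(items I), (a <= e)%N -> exists2 S, S \in L & e \in S).

Lemma coverable_step {R : realType} {n : nat} {I : chores R n} (i : 'I_n)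
    (s : R) (k a b : nat) :
  (a < items I)%N ->
  (forall q, (q <= items I)%N ->
     s <= value i (interval_bundle (items I) a q) -> (q <= b)%N) ->
  coverable I i s k.+1 a -> coverable I i s k b.
Proof.
move=> lt_am bmax [L szL [okL covL]].
have [S SL aS] := covL (Ordinal lt_am) (leqnn a).
have S_lt_b (e : 'I_(items I)) : e \in S -> (e < b)%N.
  move=> eS; have [/connected_bundleP[p [q defS]] sS] := okL S SL.
  apply: bmax; first exact: ltn_ord.
  apply: (le_trans sS); apply: le_value_subset; apply/fintype.subsetP => x.
  by move: aS eS; rewrite defS !inE /=; lia.
exists (rem S L); first by rewrite size_rem // -subn1 leq_subLR add1n.
split=> [T /mem_rem/okL //|e le_be].
have [|T TL eT] := covL e.
  by have := S_lt_b _ aS; rewrite /=; lia.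
exists T => //; move: TL; rewrite (perm_mem (perm_to_rem SL)) inE.
by case/predU1P=> // defT; have := S_lt_b e; rewrite -defT eT => /(_ isT); lia.
Qed.

(* An assignment of the items from position [a] on, given by the owner of each
   item; bundles are then automatically disjoint. *)
Definition assigns {R : realType} {n : nat} (I : chores R n) (s : 'I_n -> R)
    (U : {set 'I_n}) (a : nat) (f : 'I_(items I) -> 'I_n) : Prop :=
  (forall e : 'I_(items I), (a <= e)%N -> f e \in U) /\
  (forall i, i \in U ->
     let B := [set e : 'I_(items I) | (a <= e)%N && (f e == i)] in
     connected_bundle B /\ s i <= value i B).

Lemma assigns_end {R : realType} {n : nat} {I : chores R n} (s : 'I_n -> R)
    (U : {set 'I_n}) (a : nat) (f : 'I_(items I) -> 'I_n) :
  (forall i, s i <= 0) -> (items I <= a)%N -> assigns I s U a f.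
Proof.
move=> s_le0 le_ma.
have out_a (e : 'I_(items I)) : (a <= e)%N = false by have := ltn_ord e; lia.
split=> [e|i iU B]; first by rewrite out_a.
rewrite (_ : B = finset.set0) ?connected_bundle0 ?value_set0 //.
by apply/setP => e; rewrite !inE out_a.
Qed.

Lemma assigns_prefix {R : realType} {n : nat} {I : chores R n} (s : 'I_n -> R)
    (U : {set 'I_n}) (i : 'I_n) (a b : nat) (f : 'I_(items I) -> 'I_n) :
  (a <= b)%N -> i \in U -> s i <= value i (interval_bundle (items I) a b) ->
  assigns I s (U :\ i) b f ->
  assigns I s U a (fun e => if (e < b)%N then i else f e).
Proof.
move=> le_ab iU si [fU fok]; split=> [e le_ae|j jU B].
  by case: ltnP => // le_be; have /setD1P[] := fU e le_be.
have [eq_ji|ne_ji] := eqVneq j i.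
  rewrite (_ : B = interval_bundle (items I) a b) ?eq_ji.
    by split=> //; apply/connected_bundleP; exists a, b.
  apply/setP => e; rewrite !inE eq_ji; case: ltnP => [_|le_be].
    by rewrite eqxx.
  by have /setD1P[/negPf-> _] := fU e le_be.
have -> : B = [set e : 'I_(items I) | (b <= e)%N && (f e == j)].
  apply/setP => e; rewrite !inE; case: ltnP => [lt_eb|le_be].
    by rewrite eq_sym (negPf ne_ji) andbF.
  by rewrite (leq_trans le_ab le_be).
by apply: fok; rewrite !inE ne_ji.
Qed.

(** Induction on the number [k] of agents in [U] still to be served, [a] being the first unassigned
    item. The last hypothesis is an invariant: while items remain, so does a good agent, who can
    determine the next cut. *)
Lemma greedy_assignment {R : realType} {n : nat} {I : chores R n}
    (s : 'I_n -> R) (G U : {set 'I_n}) (d : 'I_n) (k a : nat) :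
  (forall i, s i <= 0) -> (forall i, i \notin G -> s i <= - (1 / 2)) ->
  #|U| = k ->
  (forall i, i \in U :&: G -> coverable I i (s i) k a) ->
  ((a < items I)%N -> U :&: G != finset.set0) ->
  exists f, assigns I s U a f.
Proof.
move=> s_le0 s_bad.
elim: k U a => [|k IH] U a cardU covU neUG; have [le_ma|lt_am] := leqP (items I) a;
  try by exists (fun=> d); apply: assigns_end.
  by have /set0Pn[i] := neUG lt_am; rewrite (cards0_eq cardU) !inE.
pose P (b : 'I_(items I).+1) :=
  [exists i in U :&: G, s i <= value i (interval_bundle (items I) a b)].
(* The empty prefix is acceptable because thresholds are nonpositive, so a longest acceptable prefix
   exists. *)
have Pa : P (Ordinal (ltnW lt_am : (a < (items I).+1)%N)).
  have /set0Pn[i iUG] := neUG lt_am; apply/exists_inP; exists i => //.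
  rewrite (_ : interval_bundle _ _ _ = finset.set0) ?value_set0 //.
  by apply/setP => e; rewrite !inE /=; lia.
case: (@arg_maxnP _ _ P (fun b => nat_of_ord b) Pa).
move=> b /exists_inP[g gUG sg] bmax.
have le_ab : (a <= b)%N := bmax _ Pa.
(* [b] is maximal over all remaining good agents at once, so each of them saves a bundle. *)
have covb i : i \in U :&: G -> coverable I i (s i) k b.
  move=> iUG; apply: coverable_step (lt_am) _ (covU i iUG) => q le_qm sq.
  apply: (bmax (Ordinal (le_qm : (q < (items I).+1)%N))).
  by apply/exists_inP; exists i.
have /setIP[gU gG] := gUG.
have cardD i : i \in U -> #|U :\ i| = k.
  by move=> iU; move: cardU; rewrite (cardsD1 i U) iU => -[].
have covD i : forall h, h \in (U :\ i) :&: G -> coverable I h (s h) k b.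
  by move=> h; rewrite !inE => /andP[/andP[_ hU] hG]; apply: covb; rewrite inE hU.
have [/exists_inP[i /setDP[iU iG] si]|/exists_inPn noBad] := boolP
    [exists i in U :\: G, s i <= value i (interval_bundle (items I) a b)].
  have [|f fok] := IH _ _ (cardD i iU) (covD i).
    (* [g] stays available, since the prefix goes to a bad agent. *)
    move=> _; apply/set0Pn; exists g; rewrite !inE gU gG !andbT.
    by apply: contraNneq iG => <-.
  by eexists; apply: assigns_prefix fok.
have [/set0Pn[i iUG]|/negPn/eqP UG0] := boolP (U :\: G != finset.set0).
  (* All remaining chores fall to [i], who found the prefix worse than -1/2. *)
  exists (fun e => if (e < b)%N then g else i); apply: assigns_prefix => //.
  have /setDP[iU iG] := iUG.
  split=> [e _|j jU B]; first by rewrite !inE iU andbT; apply: contraNneq iG => ->.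
  have [eq_ji|ne_ji] := eqVneq j i.
    rewrite (_ : B = interval_bundle (items I) b (items I)) ?eq_ji.
      split; first by apply/connected_bundleP; exists b, (items I).
      have := noBad i iUG; rewrite -ltNge; have := s_bad i iG.
      have := @value_disjoint_ge R n I i (interval_bundle (items I) a b)
        (interval_bundle (items I) b (items I)).
      have -> : [disjoint interval_bundle (items I) a b
                        & interval_bundle (items I) b (items I)].
        by apply/pred0P => e; rewrite !inE /=; lia.
      by move=> /(_ isT); lra.
    by apply/setP => e; rewrite !inE eq_ji eqxx ltn_ord !andbT.
  rewrite (_ : B = finset.set0) ?connected_bundle0 ?value_set0 //.
  by apply/setP => e; rewrite !inE eq_sym (negPf ne_ji) andbF.
have [|f fok] := IH _ _ (cardD g gU) (covD g); last first.
  by eexists; apply: assigns_prefix fok.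
(* Some bundle in the cover of [g] contains item [b], so [k > 0] and another agent is left; she is
   good because [U] has no bad agents. *)
move=> lt_bm; have [L szL [_ covL]] := covb g gUG.
have [S SL _] := covL (Ordinal lt_bm) (leqnn b).
have /card_gt0P[h hU] : (0 < #|U :\ g|)%N.
  by rewrite cardD //; case: L SL szL {covL} => //= S' L' _; lia.
apply/set0Pn; exists h; rewrite inE hU /=; apply: contraT => hG.
by have := finset.in_set0 h; rewrite -UG0 inE hG; case/setD1P: hU => _ ->.
Qed.

(** * Interval sums, allocations and attained extrema *)

Lemma sum_interval_bundle {V : nmodType} {m a b : nat} (F : nat -> V) :
  (b <= m)%N -> \sum_(e in interval_bundle m a b) F e = \sum_(a <= e < b) F e.
Proof.
move=> le_bm; rewrite (big_nat_widenl a 0) // (big_nat_widen 0 b m) //.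
by rewrite big_mkord; apply: eq_bigl => e; rewrite !inE.
Qed.

Lemma allocation_owner {n m : nat} (f : 'I_m -> 'I_n) :
  (forall i, connected_bundle [set e | f e == i]) ->
  allocation [ffun i => [set e | f e == i]].
Proof.
move=> f_conn; apply/and3P; split.
- by apply/forallP => i; rewrite ffunE.
- apply/forallP => i; apply/forallP => j; apply/implyP => ne_ij.
  apply/pred0P => e; rewrite !ffunE !inE /=.
  by apply/negbTE; apply: contraNN ne_ij => /andP[/eqP-> /eqP->].
- apply/eqP/setP => e; rewrite inE; apply/finset.bigcupP; exists (f e) => //.
  by rewrite ffunE inE.
Qed.

Lemma allocation_exists {n : nat} (m : nat) (d : 'I_n) :
  exists A : {ffun 'I_n -> {set 'I_m}}, allocation A.
Proof.
exists [ffun i => [set e | d == i]]; apply: (@allocation_owner _ _ (fun=> d)) => i.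
apply/connected_bundleP; exists 0%N, (if d == i then m else 0%N).
by apply/setP => e; rewrite !inE; case: (d == i); rewrite ?ltn_ord ?ltn0.
Qed.

Lemma sum_value_allocation {R : realType} {n : nat} {I : chores R n} (i : 'I_n)
    (X : {ffun 'I_n -> {set 'I_(items I)}}) :
  allocation X -> \sum_j value i (X j) = -1.
Proof.
case/and3P => _ /forallP disjX /eqP covX; rewrite -(item_value_total I i).
rewrite /value -partition_disjoint_bigcup; last first.
  by move=> j k ne_jk; have /forallP/(_ k)/implyP := disjX j; apply.
by rewrite covX; apply: eq_bigl => e; rewrite inE.
Qed.

(** [d] shows that the index type is inhabited, so the minimum is one of the values and not the
    neutral [+oo]. *)
Lemma bigmin_EFin_attained {R : realType} {n : nat} (d : 'I_n) (F : 'I_n -> R) :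
  exists2 i, \big[Order.min/+oo%E]_(j < n) (F j)%:E = (F i)%:E &
    forall j, F i <= F j.
Proof.
have [i _ eq_i] := @eq_bigmin _ _ _ +oo%E d xpredT (fun j => (F j)%:E) isT
  (fun j _ => leey _).
exists i => // j; rewrite -lee_fin -eq_i.
exact: (@bigmin_le _ _ _ +oo%E j (fun j => (F j)%:E)).
Qed.

Lemma MMS_attained {R : realType} {n : nat} (I : chores R n) (i : 'I_n) :
  exists2 mu, MMS I i = mu%:E & exists2 X : {ffun 'I_n -> {set 'I_(items I)}},
    allocation X & (forall j, mu <= value i (X j)) /\ mu <= 0.
Proof.
have [A allocA] := allocation_exists (items I) i.
have [X allocX eqX] := @eq_bigmax _ _ _ -oo%E A (@allocation n (items I))
  (fun X => \big[Order.min/+oo%E]_(j < n) (value i (X j))%:E) allocA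
  (fun _ _ => leNye _).
have [j eqj lej] := bigmin_EFin_attained i (fun j => value i (X j)).
exists (value i (X j)); first by rewrite /MMS eqX eqj.
by exists X => //; split=> //; apply: value_le0.
Qed.

Lemma EW_attained {R : realType} {n : nat} {I : chores R n} (d : 'I_n)
    (A : {ffun 'I_n -> {set 'I_(items I)}}) :
  exists2 i, EW A = (value i (A i))%:E & forall j, value i (A i) <= value j (A j).
Proof. exact: bigmin_EFin_attained d (fun i => value i (A i)). Qed.

Lemma OPT_attained {R : realType} {n : nat} (I : chores R n) (d : 'I_n) :
  exists2 A : {ffun 'I_n -> {set 'I_(items I)}}, allocation A & OPT I = EW A.
Proof.
have [A allocA] := allocation_exists (items I) d.
have [X allocX eqX] := @eq_bigmax _ _ _ -oo%E A (@allocation n (items I))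
  (@EW R n I) allocA (fun _ _ => leNye _).
by exists X.
Qed.

(** * The upper bound *)

(** The greedy assignment is started with all agents at item 0: a partition whose bundles a good
    agent all accepts is a cover by at most [n] bundles. *)
Lemma threshold_allocation {R : realType} {n : nat} {I : chores R n}
    (s : 'I_n -> R) (G : {set 'I_n}) :
  (forall i, s i <= 0) -> (forall i, i \notin G -> s i <= - (1 / 2)) ->
  (forall i, i \in G -> exists2 X : {ffun 'I_n -> {set 'I_(items I)}},
     allocation X & forall j, s i <= value i (X j)) ->
  G != finset.set0 ->
  exists2 A : {ffun 'I_n -> {set 'I_(items I)}},
    allocation A & forall i, s i <= value i (A i).
Proof.
move=> s_le0 s_bad s_good neG; have /set0Pn[d _] := neG.
have [i|_|f [_ fok]] := @greedy_assignment R n I s G [set: 'I_n]%SET d #|[set: 'I_n]%SET| 0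
  s_le0 s_bad erefl; last first.
- exists [ffun i => [set e | f e == i]].
    by apply: allocation_owner => i; have [] := fok i (finset.in_setT i).
  by move=> i; rewrite ffunE; have [] := fok i (finset.in_setT i).
- by rewrite finset.setTI.
rewrite finset.setTI => /s_good[X /and3P[/forallP connX _ /eqP covX] sX].
exists [seq X j | j <- enum 'I_n].
  by rewrite size_map -cardE; apply: subset_leq_card; apply/fintype.subsetP.
split=> [S /mapP[j _ ->] //|e _].
have := finset.in_setT e.
by rewrite -covX => /finset.bigcupP[j _ ej]; exists (X j); rewrite ?map_f ?mem_enum.
Qed.

Lemma fair_ratio_le {R : realType} {n : nat} (I : chores R n) :
  (2 <= n)%N -> exists2 A : {ffun 'I_n -> {set 'I_(items I)}},
    MMS_fair A & (welfare_ratio (EW A) (OPT I) <= (n%:R / 2)%:E)%E.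
Proof.
move=> le2n; have lt0n : (0 < n)%N by lia.
have le2nR : 2 <= n%:R :> R by rewrite ler_nat.
have [B allocB optB] := OPT_attained I (Ordinal lt0n).
have [i0 ewB leB] := EW_attained (Ordinal lt0n) B.
set w := value i0 (B i0) in ewB leB.
have w_le0 : w <= 0 := value_le0 _ _.
have [/forallP fairB|/forallPn[j]] :=
    boolP [forall i, (MMS I i <= (value i (B i))%:E)%E].
  (* A fair optimal allocation has ratio 1, by convention also for 0/0, and [1 <= n / 2]. *)
  exists B; first by rewrite /MMS_fair allocB; apply/forallP.
  rewrite optB ewB /welfare_ratio eqe; case: eqVneq => [_|w_neq0].
    by rewrite lee_fin; lra.
  by rewrite lee_fin /= divff //; lra.
have /all_sig2[mu MMSmu muP] : forall i, {m : R | MMS I i = m%:E &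
    exists2 X : {ffun 'I_n -> {set 'I_(items I)}},
    allocation X & (forall j, m <= value i (X j)) /\ m <= 0}.
  by move=> i; apply: cid2; apply: MMS_attained.
rewrite MMSmu lee_fin -ltNge => lt_mu.
have w_lt_mu : w < mu j := le_lt_trans (leB j) lt_mu.
(* Agent [j] values each of the [n] bundles of her maximin partition at least [mu j > w], and these
   values sum to -1. *)
have nw_le : n%:R * w <= -1.
  have [X allocX [muX _]] := muP j.
  apply: (@le_trans _ _ (n%:R * mu j)); first by rewrite ler_wpM2l // ltW.
  rewrite -(sum_value_allocation j _ allocX) mulr_natl -{1}(card_ord n) -sumr_const.
  exact: ler_sum.
pose T := n%:R / 2 * w.
have T_le : T <= - (1 / 2) by rewrite /T; lra.
(* Since [n / 2 >= 1] and [w <= 0], [T <= w < mu j]; thus [j] is good. *)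
have T_lt_mu : T < mu j by rewrite /T; nra.
(* The threshold is [mu i] for good agents, met by their maximin partitions, and [T <= -1/2] for bad
   ones. *)
have [||i||A allocA sA] := @threshold_allocation R n I
  (fun i => Num.max (mu i) T) [set i | T <= mu i].
- by move=> i; have [X _ [_ mu0]] := muP i; rewrite ge_max mu0; lra.
- by move=> i; rewrite inE -ltNge => ltT; rewrite ge_max; apply/andP; split; lra.
- rewrite inE => leT; have [X allocX [muX _]] := muP i.
  by exists X => // k; rewrite max_l.
- by apply/set0Pn; exists j; rewrite inE ltW.
exists A.
  rewrite /MMS_fair allocA; apply/forallP => i; rewrite MMSmu lee_fin.
  by apply: le_trans (sA i); rewrite le_max lexx.
have [i ewA _] := EW_attained (Ordinal lt0n) A.
have w_lt0 : w < 0 by nra.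
rewrite ewA optB ewB /welfare_ratio eqe lt_eqF // lee_fin /= ler_ndivrMr //.
by apply: le_trans (sA i); rewrite le_max lexx orbT.
Qed.

(** * The lower bound: a family of tight instances *)

(** Items count from 0. The default of [nth] makes every item from 2 on cost agent 0 exactly 1/n, so
    [n.+1] items give her total cost 1. *)
Definition tight_value (R : realType) (n : nat) (x : R) (i e : nat) : R :=
  if i == 0%N then - (nth 1 [:: 1 - x; x] e / n%:R)
  else if (e == 1%N) || (e == 2%N) then - (1 / 2) else 0.

Lemma tight_value_le0 (R : realType) (n : nat) (x : R) (i e : nat) :
  0 <= x <= 1 -> tight_value R n x i e <= 0.
Proof.
case/andP => x_ge0 x_le1; rewrite /tight_value; case: eqP => _; last first.
  by case: orP => _; lra.
rewrite oppr_le0 divr_ge0 //.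
by case: e => [|[|[|e]]] /=; lra.
Qed.

Lemma tight_value_total (R : realType) (n : nat) (x : R) (i : nat) :
  (2 <= n)%N -> \sum_(e < n.+1) tight_value R n x i e = -1.
Proof.
case: n => [|[|k]] // _; rewrite -(big_mkord xpredT (tight_value R k.+2 x i)).
have k2_neq0 : k.+2%:R != 0 :> R by rewrite pnatr_eq0.
rewrite !big_nat_recl // /tight_value; case: eqP => _ /=.
  rewrite (eq_bigr (fun=> - (1 / k.+2%:R))) => [|e _] //.
  rewrite sumr_const_nat subn0 -mulr_natr.
  by move: k2_neq0; rewrite !mulrS => k2_neq0; field.
by rewrite big1 //; lra.
Qed.

Definition tight_chores {R : realType} {n : nat} {x : R} (hn : (2 <= n)%N)
    (hx : 0 <= x <= 1) : chores R n :=
  @Chores R n n.+1 (fun i e => tight_value R n x i e)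
    (fun i e => tight_value_le0 R n x i e hx)
    (fun i => tight_value_total R n x i hn).

Lemma tight_value_interval {R : realType} {n : nat} {x : R} (hn : (2 <= n)%N)
    (hx : 0 <= x <= 1) (i : 'I_n) (a b : nat) : (b <= n.+1)%N ->
  @value R n (tight_chores hn hx) i (interval_bundle n.+1 a b) =
  \sum_(a <= e < b) tight_value R n x i e.
Proof. exact: sum_interval_bundle. Qed.

(** The blocks {0, 1}, {2}, ..., {n} cost agent 0 exactly 1/n each. [f] sends item [e] to block
    [e.-1]; truncation at 0 puts items 0 and 1 together. *)
Lemma tight_MMS_ge {R : realType} {n : nat} {x : R} (hn : (2 <= n)%N)
    (hx : 0 <= x <= 1) (i : 'I_n) : i = 0%N :> nat ->
  ((- (1 / n%:R))%:E <= MMS (tight_chores hn hx) i)%E.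
Proof.
move=> i0; have n_gt0 : 0 < n%:R :> R by rewrite ltr0n; lia.
have pred_lt (e : 'I_n.+1) : (e.-1 < n)%N by have := ltn_ord e; lia.
pose f (e : 'I_n.+1) := Ordinal (pred_lt e).
have bundleE j : [set e | f e == j] =
    interval_bundle n.+1 (if j == 0%N :> nat then 0%N else j.+1) j.+2.
  apply/setP => e; rewrite !inE -val_eqE /=; case: j => j lt_jn /=.
  by case: ifP => /eqP; lia.
have alloc_f := @allocation_owner n n.+1 f.
apply: bigmax_sup (alloc_f _) _ => [j|].
  by apply/connected_bundleP; rewrite bundleE; eexists; eexists; reflexivity.
apply: le_bigmin => [|j _]; first exact: leey.
rewrite lee_fin ffunE bundleE tight_value_interval; last by rewrite !ltnS.
case: eqP => [->|/eqP j_neq0].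
  by rewrite !big_nat_recl // big_geq // /tight_value i0 /=; lra.
rewrite big_nat1 /tight_value i0 /=.
by case: (nat_of_ord j) j_neq0 => [|[|j']] _ //=; rewrite lexx.
Qed.

(** Items 1 and 2 together cost agent 0 [(1 + x) / n], more than her maximin share allows, so some
    other agent holds one of them, at cost 1/2. *)
Lemma tight_fair_EW_le {R : realType} {n : nat} {x : R} (hn : (2 <= n)%N)
    (hx : 0 <= x <= 1) (A : {ffun 'I_n -> {set 'I_n.+1}}) :
  0 < x -> @MMS_fair R n (tight_chores hn hx) A ->
  (@EW R n (tight_chores hn hx) A <= (- (1 / 2))%:E)%E.
Proof.
move=> x_gt0 /andP[/and3P[_ _ /eqP covA] /forallP fairA].
have n_gt0 : 0 < n%:R :> R by rewrite ltr0n; lia.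
have owner (e : 'I_n.+1) : exists i, e \in A i.
  have := finset.in_setT e; rewrite -covA => /finset.bigcupP[i _ ei].
  by exists i.
have heavy (i : 'I_n) (e : 'I_n.+1) : i != 0%N :> nat ->
    (e == 1%N :> nat) || (e == 2%N :> nat) -> e \in A i ->
    (@EW R n (tight_chores hn hx) A <= (- (1 / 2))%:E)%E.
  move=> i_neq0 e12 eA; apply: le_trans (bigmin_le _ i _) _.
  rewrite lee_fin.
  have := @le_value_subset R n (tight_chores hn hx) i [set e] (A i).
  rewrite finset.sub1set => /(_ eA); rewrite [leRHS]big_set1 /=.
  by rewrite /tight_value (negPf i_neq0) e12.
have lt1 : (1 < n.+1)%N by lia.
have lt2 : (2 < n.+1)%N by lia.
have [i1 i1A] := owner (Ordinal lt1).
have [i2 i2A] := owner (Ordinal lt2).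
have [i1_0|i1_neq0] := eqVneq (nat_of_ord i1) 0%N; last exact: heavy i1A.
have [i2_0|i2_neq0] := eqVneq (nat_of_ord i2) 0%N; last exact: heavy i2A.
have eq12 : i2 = i1 by apply: val_inj; rewrite /= i1_0.
have := le_trans (tight_MMS_ge hn hx i1 i1_0) (fairA i1); rewrite lee_fin.
have : interval_bundle n.+1 1 3 \subset A i1.
  apply/fintype.subsetP => e; rewrite inE => e12.
  have [e1|e1] := eqVneq (nat_of_ord e) 1%N.
    by rewrite (_ : e = Ordinal lt1) //; apply: val_inj.
  rewrite (_ : e = Ordinal lt2) -?eq12 //; apply: val_inj => /=; lia.
move=> /(@le_value_subset R n (tight_chores hn hx) i1).
rewrite tight_value_interval // big_ltn // big_nat1 /tight_value i1_0 /=.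
by move=> ? ?; exfalso; have := divr_gt0 x_gt0 n_gt0; lra.
Qed.

(** Agent 0 takes {1, 2}, agent 1 takes {0} and agent [n.-1] the rest. For [n = 2] the last two
    agents coincide, but then there is no item from 3 on. *)
Lemma tight_OPT_ge {R : realType} {n : nat} {x : R} (hn : (2 <= n)%N)
    (hx : 0 <= x <= 1) :
  ((- ((1 + x) / n%:R))%:E <= OPT (tight_chores hn hx))%E.
Proof.
have /andP[x_ge0 _] := hx.
have n_gt0 : 0 < n%:R :> R by rewrite ltr0n; lia.
have lt0n : (0 < n)%N by lia.
have lt1n : (1 < n)%N by lia.
have ltpn : (n.-1 < n)%N by lia.
pose f (e : 'I_n.+1) : 'I_n := if (e == 0%N :> nat) then Ordinal lt1n
  else if (e < 3)%N then Ordinal lt0n else Ordinal ltpn.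
have fE e : nat_of_ord (f e) = if (e == 0%N :> nat) then 1%N
  else if (e < 3)%N then 0%N else n.-1.
  by rewrite /f; do !case: ifP.
have conn_f i : connected_bundle [set e | f e == i].
  pose a := if i == 0%N :> nat then 1%N else if i == 1%N :> nat then 0%N
    else if i == n.-1 :> nat then 3%N else 0%N.
  pose b := if i == 0%N :> nat then 3%N else if i == 1%N :> nat then 1%N
    else if i == n.-1 :> nat then n.+1 else 0%N.
  apply/connected_bundleP; exists a, b; apply/setP => e.
  rewrite !inE -val_eqE /= fE {}/a {}/b; have := ltn_ord i; have := ltn_ord e.
  by do !case: ifP; lia.
apply: bigmax_sup (@allocation_owner n n.+1 f conn_f) _.
apply: le_bigmin => [|j _]; first exact: leey.
rewrite lee_fin ffunE.
have [j0|j_neq0] := eqVneq (nat_of_ord j) 0%N.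
  rewrite (_ : [set _ | _] = interval_bundle n.+1 1 3).
    rewrite tight_value_interval // big_ltn // big_nat1 /tight_value j0 /=.
    lra.
  by apply/setP => e; rewrite !inE -val_eqE /= fE j0; do !case: ifP; lia.
rewrite [leRHS]big1 ?oppr_le0 ?divr_ge0 // ?addr_ge0 // => e.
rewrite inE -val_eqE /= fE => fe; rewrite /tight_value (negPf j_neq0).
case: ifP => // e12; move: fe e12 j_neq0.
by do !case: ifP; lia.
Qed.

Lemma tight_price_ge {R : realType} {n : nat} {x : R} (hn : (2 <= n)%N)
    (hx : 0 <= x <= 1) : 0 < x ->
  ((n%:R / 2 / (1 + x))%:E <= instance_price (tight_chores hn hx))%E.
Proof.
move=> x_gt0; have n_gt0 : 0 < n%:R :> R by rewrite ltr0n; lia.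
have lt0n : (0 < n)%N by lia.
apply: le_bigmin => [|A fairA]; first exact: leey.
have [B _ optB] := OPT_attained (tight_chores hn hx) (Ordinal lt0n).
have [i ewB _] := EW_attained (Ordinal lt0n) B.
have [j ewA _] := EW_attained (Ordinal lt0n) A.
have := tight_OPT_ge hn hx; have := tight_fair_EW_le hn hx _ x_gt0 fairA.
rewrite optB ewA ewB !lee_fin /welfare_ratio !eqe => c_le o_ge.
have := @value_le0 R n (tight_chores hn hx) i (B i).
move: (value j (A j)) (value i (B i)) c_le o_ge => c o c_le o_ge o_le0.
(* If [o = 0], the ratio is [+oo] because [c <= -1/2]. *)
have [o0|o_neq0] := eqVneq o 0; first by rewrite lt_eqF ?leey //; lra.
rewrite lee_fin /= ler_ndivlMr ?lt_neqAle ?o_neq0 //; apply: (le_trans c_le).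
have x1_gt0 : 0 < 1 + x by lra.
rewrite (_ : - (1 / 2) = n%:R / 2 / (1 + x) * - ((1 + x) / n%:R)).
  by rewrite ler_wpM2l // !divr_ge0 ?ltW.
by field; rewrite !lt0r_neq0.
Qed.

Theorem theorem20 (R : realType) (n : nat) (hn : (2 <= n)%N) :
  PoF R n = (n%:R / 2)%:E.
Proof.
apply/eqP; rewrite eq_le; apply/andP; split.
  apply: ge_ereal_sup => _ [I _ <-].
  have [A fairA ratioA] := fair_ratio_le I hn.
  exact: le_trans (bigmin_le_cond _ _ fairA) ratioA.
apply/lee_addgt0Pr => d d_gt0.
have n_gt0 : 0 < n%:R :> R by rewrite ltr0n; lia.
(* The loss [n/2 - n/2/(1 + x)] is at most [n * x], which [d / n] keeps within [d]; the minimum with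
   1 ensures [x <= 1]. *)
pose x := Num.min 1 (d / n%:R).
have x_gt0 : 0 < x by rewrite lt_min ltr01 divr_gt0.
have hx : 0 <= x <= 1 by rewrite (ltW x_gt0) ge_min lexx.
have nx_le : n%:R * x <= d.
  by rewrite -[leRHS](@divfK _ n%:R) ?lt0r_neq0 // mulrC ler_pM2r // ge_min lexx orbT.
apply: (@le_trans _ _ ((n%:R / 2 / (1 + x))%:E + d%:E)%E).
  rewrite -EFinD lee_fin -lerBlDr ler_pdivlMr; last by lra.
  by nra.
apply: leeD => //; apply: le_trans (tight_price_ge hn hx x_gt0) _.
by apply: ereal_sup_ubound; exists (tight_chores hn hx).
Qed.
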